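(* Let $C_1,\dots,C_s$ be the finite decomposition of $X_*^+\times X_*^+$ attached to a Presburger presentation of the function $(\mu,\lambda)\mapsto P_{\mu,\lambda}(q)$. Fix $(\mu,\lambda)\in X_*^+\times X_*^+$ and let $B>0$ be such that there is $C_b$ such that $(\mu,N\lambda)\in C_b$ for all $N>B$. Then there exists an integer $M=M(C_b)$ such that if the congruence class $N\equiv m\bmod M$ of $N$ is fixed, we have (for $N>B$ in this class): (a) $$P_{\mu,N\lambda}(q)=\sum_{i=1}^nA_{i,b,m}(N)\,\bigl(q^{a^\lambda_{i,b,m}}\bigr)^N$$ for polynomial functions $A_{i,b,m}$ and integers $a^\lambda_{i,b,m}$; (b) the function $$N\mapsto f_\mu(N\lambda)=P_{\mu,N\lambda}(q),\qquad N\equiv m\bmod M,$$ satisfies a finite linear recurrence relation in $N$ with constant coefficients. The recurrence relation depends only on the triple $(C_b,m,M(C_b))$.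
   Context: $G$ is a split connected reductive group with finite Weyl group $W$, cocharacter lattice $X_*$ and dominant cocharacters $X_*^+$. For $\mu,\lambda\in X_*^+$, $P_{\mu,\lambda}(q)$ is the spherical Kazhdan-Lusztig polynomial, i.e. the Kazhdan-Lusztig polynomial of the longest elements of the $W$-double cosets of the translations $\mu$ and $\lambda$ in the extended affine Weyl group $W\ltimes X_*$ (zero unless $\mu\le\lambda$). In (b), $f_\mu(N\lambda)$ is notation for $P_{\mu,N\lambda}(q)$; the symbol $f_\mu$ is used because there are bases $\{f_\mu\}$ of certain pieces of the asymptotic Hecke algebra whose values on dominant translations are given, up to explicit factors and a shift of the argument, by these polynomials. Presburger presentation: by a result of Casselman-Cely-Hales, the function $P(\mu,\lambda)=P_{\mu,\lambda}(q)$ on $X_*^+\times X_*^+$ is constructible with respect to the Presburger language, meaning that $$P_{\mu,\lambda}(q)=\sum_{i=1}^n\frac{\prod_j\beta_{i,j}(\mu,\lambda)\,q^{\alpha_i(\mu,\lambda)}}{\prod_k(1-q^{a_{ik}})}$$ for Presburger-definable functions $\alpha_i$ and $\beta_{i,j}$, with the factors $\prod_k(1-q^{a_{ik}})$ constant with respect to $\mu,\lambda$. Definability means that there is a decomposition of $X_*^+\times X_*^+$ into finitely many subsets $C_1,\dots,C_s$ defined by linear inequalities and congruence conditions, such that on each $C=C_b$ all the functions $\alpha_i|_C$ and $\beta_{i,j}|_C$ are affine, i.e. of the form $(\mu,\lambda)\mapsto a^\lambda\cdot\lambda+a^\mu\cdot\mu+a^0$. Such a presentation and decomposition are fixed.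
   Formalization: The recurrence's order depends only on (C_b, m, M), but its coefficients may also depend on λ (not on μ or B). Independence of λ is false: for PGL3, P_{0,aρ}=1+…+q^a, and infinitely many rays Nkρ end in one cell with distinct characteristic roots q^{kM}. *)

(* Defs.v *)
(* MathComp, with mathcomp.classical for sets, choice and finitely supported sums. *)
From mathcomp Require Import all_boot all_order all_algebra.
From mathcomp Require Import boolp classical_sets fsbigop.

Set Implicit Arguments.
Unset Strict Implicit.
Unset Printing Implicit Defensive.

Import Order.TTheory GRing.Theory Num.Theory.
Local Open Scope ring_scope.

(* Characters are row vectors, cocharacters are column vectors. *)
Definition pair_int r (a : 'rV[int]_r) (x : 'cV[int]_r) : int := (a *m x) 0 0.

(* A reduced root datum with a choice of positive roots, i.e. the combinatorial
   datum of a split connected reductive group with a Borel pair (T, B).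
   Positive systems are the subsets of the roots that are closed under addition
   and contain exactly one of each pair of opposite roots. *)
Record root_datum := RootDatum {
  rd_rank : nat;
  rd_nroots : nat;
  rd_root : 'I_rd_nroots -> 'rV[int]_rd_rank;
  rd_coroot : 'I_rd_nroots -> 'cV[int]_rd_rank;
  rd_pos : {set 'I_rd_nroots};
  rd_root_inj : injective rd_root;
  rd_coroot_inj : injective rd_coroot;
  rd_pair2 : forall i, pair_int (rd_root i) (rd_coroot i) = 2;
  rd_refl_root : forall i j, exists k,
    rd_root k = rd_root j - pair_int (rd_root j) (rd_coroot i) *: rd_root i;
  rd_refl_coroot : forall i j, exists k,
    rd_coroot k =
      rd_coroot j - pair_int (rd_root i) (rd_coroot j) *: rd_coroot i;
  rd_reduced : forall i j, rd_root j != 2 *: rd_root i;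
  rd_pos_opp : forall i j, rd_root j = - rd_root i ->
    (j \in rd_pos) = (i \notin rd_pos);
  rd_pos_add : forall i j k, i \in rd_pos -> j \in rd_pos ->
    rd_root k = rd_root i + rd_root j -> k \in rd_pos
}.

Section ExtendedAffineWeylGroup.
Variable D : root_datum.

Definition cochar := 'cV[int]_(rd_rank D).

Definition dominant (x : cochar) : Prop :=
  forall i, i \in rd_pos D -> 0 <= pair_int (rd_root i) x.

Definition refl (i : 'I_(rd_nroots D)) : 'M[int]_(rd_rank D) :=
  1%:M - rd_coroot i *m rd_root i.

Inductive weyl : 'M[int]_(rd_rank D) -> Prop :=
| weyl1 : weyl 1%:M
| weylM i w : weyl w -> weyl (refl i *m w).

(* The pair (w, t) is the affine map x |-> w x + t of X_*. *)
Definition aff := ('M[int]_(rd_rank D) * 'cV[int]_(rd_rank D))%type.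
Definition aff_mul (g h : aff) : aff := (g.1 *m h.1, g.1 *m h.2 + g.2).
Definition transl (x : cochar) : aff := (1%:M, x).

(* membership in the extended affine Weyl group *)
Definition ext (g : aff) : Prop := weyl g.1.

(* reflection in the hyperplane <alpha_i, x> = k *)
Definition aff_refl (i : 'I_(rd_nroots D)) (k : int) : aff :=
  (refl i, k *: rd_coroot i).

Definition neg_char (a : 'rV[int]_(rd_rank D)) : bool :=
  [exists j, (j \notin rd_pos D) && (rd_root j == a)].

(* Iwahori-Matsumoto length: the number of hyperplanes <alpha, x> = k that
   separate the alcove { 0 < <alpha, x> < 1 for all alpha > 0 } from its image.
   On the image under (w, t), <alpha, x> lies between m and m + 1 with
   m = <alpha, t> if w^-1 alpha > 0 and m = <alpha, t> - 1 otherwise, where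
   w^-1 alpha is the character alpha *m w.  It extends the Coxeter length by 0
   on the stabilizer of the alcove. *)
Definition len (g : aff) : nat :=
  (\sum_(i in rd_pos D)
     absz (pair_int (rd_root i) g.2 - (neg_char (rd_root i *m g.1))%:Z))%N.

(* the reflections in the walls of the base alcove *)
Definition simple_refl (s : aff) : Prop :=
  (exists i k, s = aff_refl i k) /\ len s = 1%N.

Inductive bruhat (x : aff) : aff -> Prop :=
| bruhat_refl : bruhat x x
| bruhat_step y i k : bruhat x y ->
    (len y < len (aff_mul y (aff_refl i k)))%N ->
    bruhat x (aff_mul y (aff_refl i k)).

(* Characterizations of the R-polynomials and of the Kazhdan-Lusztig
   polynomials as in Bjorner-Brenti, Combinatorics of Coxeter groups,
   Theorems 5.1.1 and 5.1.4; the variable 'X is q.  Elements in different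
   cosets of the affine Weyl group are incomparable, which gives the usual
   extension to the extended group. *)
Definition R_family (R : aff -> aff -> {poly int}) : Prop :=
  [/\ forall x y, ext x -> ext y -> ~ bruhat x y -> R x y = 0,
      forall x, ext x -> R x x = 1
    & forall x y s, ext x -> ext y -> simple_refl s ->
        (len (aff_mul y s) < len y)%N ->
        R x y = if (len (aff_mul x s) < len x)%N
                then R (aff_mul x s) (aff_mul y s)
                else 'X * R (aff_mul x s) (aff_mul y s)
                     + ('X - 1) * R x (aff_mul y s)].

(* q^n p(q^-1), for p of degree at most n *)
Definition poly_rev (n : nat) (p : {poly int}) : {poly int} :=
  \poly_(k < n.+1) p`_(n - k).

Definition KL_family (P : aff -> aff -> {poly int}) : Prop :=
  exists2 R, R_family R &
  [/\ forall x y, ext x -> ext y -> ~ bruhat x y -> P x y = 0,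
      forall x, ext x -> P x x = 1,
      forall x y, ext x -> ext y -> bruhat x y -> x <> y ->
        (((size (P x y)).-1).*2 < len y - len x)%N
    & forall x y, ext x -> ext y -> bruhat x y ->
        poly_rev (len y - len x) (P x y) =
        \sum_(z \in [set z | bruhat x z /\ bruhat z y]%classic)
           R x z * P z y].

(* By Kazhdan-Lusztig there is, on the extended affine Weyl group, exactly one
   KL_family; xget selects it. *)
Definition KL_poly : aff -> aff -> {poly int} :=
  xget (fun _ _ => 0) [set P | KL_family P]%classic.

Definition double_coset (x : cochar) (g : aff) : Prop :=
  exists u v, [/\ weyl u, weyl v &
    g = aff_mul (aff_mul (u, 0) (transl x)) (v, 0)].

Definition is_longest (x : cochar) (g : aff) : Prop :=
  double_coset x g /\ forall h, double_coset x h -> (len h <= len g)%N.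

(* the longest element of W x W, which is unique *)
Definition longest (x : cochar) : aff :=
  xget (transl x) [set g | is_longest x g]%classic.

Definition sphKL (mu lam : cochar) : {poly int} :=
  KL_poly (longest mu) (longest lam).

End ExtendedAffineWeylGroup.

Notation Qq := {fraction {poly int}}.
Definition q : Qq := tofrac 'X.

(* (c_mu, c_lam, c_0) : (mu, lam) |-> c_mu . mu + c_lam . lam + c_0 *)
Record int_form r := IntForm {
  if_mu : 'rV[int]_r; if_lam : 'rV[int]_r; if_cst : int }.

Definition form_eval r (f : int_form r) (mu lam : 'cV[int]_r) : int :=
  pair_int (if_mu f) mu + pair_int (if_lam f) lam + if_cst f.

(* finitely many inequalities f >= 0 and congruences f = 0 mod k, k > 0 *)
Record cell r := Cell {
  cell_ineqs : seq (int_form r);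
  cell_congs : seq (int_form r * nat);
  cell_mod_gt0 : all (fun c => 0 < c.2)%N cell_congs }.

Definition in_cell r (C : cell r) (mu lam : 'cV[int]_r) : bool :=
  all (fun f => 0 <= form_eval f mu lam) (cell_ineqs C) &&
  all (fun c => (c.2%:Z %| form_eval c.1 mu lam)%Z) (cell_congs C).

Definition pair_rat r (a : 'rV[rat]_r) (x : 'cV[int]_r) : rat :=
  (a *m map_mx intr x) 0 0.

(* The coefficients are rational: an integer-valued function that is affine on
   a congruence class, such as x |-> x / 2 on the even integers, need not have
   integral coefficients. *)
Definition affine_on (D : root_datum) (C : cell (rd_rank D))
    (f : cochar D -> cochar D -> int) : Prop :=
  exists (alam amu : 'rV[rat]_(rd_rank D)) (a0 : rat),
    forall mu lam, dominant mu -> dominant lam -> in_cell C mu lam ->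
      (f mu lam)%:~R = pair_rat alam lam + pair_rat amu mu + a0.

(* A Presburger presentation of (mu, lam) |-> P_{mu,lam}(q), together with an
   attached decomposition of X_*^+ x X_*^+. *)
Record presburger_presentation (D : root_datum) := PresburgerPresentation {
  pp_n : nat;
  pp_alpha : 'I_pp_n -> cochar D -> cochar D -> int;
  pp_nbeta : 'I_pp_n -> nat;
  pp_beta : forall i, 'I_(pp_nbeta i) -> cochar D -> cochar D -> int;
  pp_nden : 'I_pp_n -> nat;
  pp_a : forall i, 'I_(pp_nden i) -> int;
  pp_a_neq0 : forall i (k : 'I_(pp_nden i)), pp_a k != 0;
  pp_formula : forall mu lam, dominant mu -> dominant lam ->
    tofrac (sphKL mu lam) =
    \sum_(i < pp_n)
      (\prod_(j < pp_nbeta i) (pp_beta j mu lam)%:~R) * q ^ pp_alpha i mu lam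
      / \prod_(k < pp_nden i) (1 - q ^ pp_a k) :> Qq;
  pp_s : nat;
  pp_cell : 'I_pp_s -> cell (rd_rank D);
  pp_cover : forall mu lam : cochar D, dominant mu -> dominant lam ->
    exists b, in_cell (pp_cell b) mu lam;
  pp_disjoint : forall b b' (mu lam : cochar D), dominant mu -> dominant lam ->
    in_cell (pp_cell b) mu lam -> in_cell (pp_cell b') mu lam -> b = b';
  pp_alpha_affine : forall b i, affine_on (pp_cell b) (pp_alpha i);
  pp_beta_affine : forall b i (j : 'I_(pp_nbeta i)),
    affine_on (pp_cell b) (pp_beta j)
}.

(* Main.v *)
Require Import Defs.
From mathcomp Require Import all_boot all_order all_algebra.
From mathcomp Require Import boolp.

Import Order.TTheory GRing.Theory Num.Theory.
Local Open Scope ring_scope.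

(** Along a ray N |-> (mu, N lam) that stays in a cell for N large, an
    integer-valued affine function equals s N + t; its slope s is the difference
    of two consecutive values, hence an integer, even though the coefficients are
    only rational.  So M = 1 suffices.  The i-th term of the presentation becomes
    A_i(N) x_i^N with x_i = q^(s_i) depending only on the cell and on lam, and
    deg A_i at most the number of factors beta_(i,j).  Since X - x lowers the
    degree of A when it acts by shifts on A(N) x^N, the polynomial
    prod_i (X - x_i)^(1 + number of factors) annihilates the whole sequence. *)

(** The shift by 1 preserves both degree and leading coefficient, so the top coefficients cancel. *)
Lemma size_poly_diff (F : idomainType) (A : {poly F}) :
  (size (A \Po ('X + 1%:P) - A)%R <= (size A).-1)%N.
Proof.
have sX : size ('X + 1%:P : {poly F}) = 2 by rewrite size_XaddC.
have sC : size (A \Po ('X + 1%:P)) = size A by rewrite size_comp_poly2.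
apply/leq_sizeP => j; rewrite leq_eqVlt => /predU1P[<-|lt_j].
  rewrite coefB -{1}sC -!lead_coefE lead_coef_comp ?sX //.
  by rewrite lead_coefXaddC expr1n mulr1 subrr.
have le_j : (size A <= j)%N by case: (size A) lt_j.
by rewrite coefB !nth_default ?sC ?subrr.
Qed.

(** Summation by parts: a factor ['X - x%:P] of the characteristic polynomial is traded for a
    twisted difference of the sequence. The two boundary terms vanish, the upper one because
    [size p <= K]. *)
Lemma sum_coef_XsubC_mul (F : comNzRingType) (x : F) (p : {poly F})
    (v : nat -> F) (K : nat) : (size p <= K)%N ->
  \sum_(k < K.+1) (('X - x%:P) * p)`_k * v k =
  \sum_(k < K) p`_k * (v k.+1 - x * v k).
Proof.
move=> le_pK.
under eq_bigr do rewrite mulrBl coefB coefXM coefCM mulrBl.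
rewrite sumrB big_ord_recl /= mul0r add0r.
rewrite [X in _ - X]big_ord_recr /= nth_default // mulr0 mul0r addr0 -sumrB.
by apply: eq_bigr => k _; rewrite mulrBr mulrCA mulrA.
Qed.

(** Induction on [s], each factor ['X - x%:P] lowering the degree of [A]. The cofactor [r] leaves
    room for the factors belonging to the other terms of a sum. *)
Lemma annihilate_polyexp (F : idomainType) (x : F) (s : nat) :
  forall (r A : {poly F}) (K : nat),
  (size A <= s)%N -> (size (('X - x%:P) ^+ s * r)%R <= K)%N ->
  \sum_(k < K) (('X - x%:P) ^+ s * r)`_k * (A.[k%:R] * x ^+ k) = 0.
Proof.
elim: s => [|s IHs] r A K sA sK.
  move: sA; rewrite leqn0 size_poly_eq0 => /eqP->.
  by rewrite big1 // => k _; rewrite horner0 mul0r mulr0.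
have [-> | r_neq0] := eqVneq r 0.
  by rewrite mulr0 big1 // => k _; rewrite coef0 mul0r.
set p := ('X - x%:P) ^+ s * r in IHs *.
have p_neq0 : p != 0 by rewrite mulf_neq0 ?expf_neq0 ?polyXsubC_eq0.
have Ep : ('X - x%:P) ^+ s.+1 * r = ('X - x%:P) * p by rewrite exprS mulrA.
rewrite Ep in sK *.
case: K sK => [|K]; first by rewrite big_ord0.
rewrite size_mul ?polyXsubC_eq0 // size_XsubC ltnS => sK.
rewrite (@sum_coef_XsubC_mul _ x p (fun k => A.[k%:R] * x ^+ k)) //.
(* Indeed [A(k+1) x^(k+1) - x A(k) x^k = x (A(k+1) - A(k)) x^k]. *)
rewrite -[RHS](IHs r (x *: (A \Po ('X + 1%:P) - A)) K) //.
  apply: eq_bigr => k _; congr (_ * _).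
  rewrite hornerZ hornerD hornerN horner_comp !hornerE /= natr1 exprS.
  by rewrite mulrBr mulrBl !mulrA; congr (_ - _); rewrite [x * _]mulrC.
apply: leq_trans (size_scale_leq _ _) (leq_trans (size_poly_diff _ _) _).
by case: (size A) sA.
Qed.

Lemma size_prod_exp_XsubC (F : idomainType) (n : nat) (e : 'I_n -> nat)
    (x : 'I_n -> F) :
  size (\prod_(i < n) ('X - (x i)%:P) ^+ e i) = (\sum_(i < n) e i).+1.
Proof.
rewrite size_prod => [|i _]; last by rewrite expf_neq0 ?polyXsubC_eq0.
under eq_bigr do rewrite size_exp_XsubC -addn1.
by rewrite big_split /= sum1_card -addSn addnK.
Qed.

Lemma annihilate_sum_polyexp (F : idomainType) (n : nat) (e : 'I_n -> nat)
    (x : 'I_n -> F) (A : 'I_n -> {poly F}) (N : nat) :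
  (forall i, size (A i) <= e i)%N ->
  \sum_(k < (\sum_(i < n) e i).+1)
     (\prod_(i < n) ('X - (x i)%:P) ^+ e i)`_k *
     (\sum_(i < n) (A i).[(N + k)%:R] * x i ^+ (N + k)) = 0.
Proof.
move=> sA; under eq_bigr do rewrite mulr_sumr.
rewrite exchange_big big1 //= => i _.
(* The starting point [N] is absorbed into the polynomial: a shift of the argument and the constant
   [x i ^+ N], neither of which raises the degree. *)
have sX : size (A i \Po ('X + N%:R%:P)) = size (A i).
  by rewrite size_comp_poly2 // size_XaddC.
have sP := eq_leq (size_prod_exp_XsubC _ _ e x).
have sZ : (size (x i ^+ N *: (A i \Po ('X + N%:R%:P)))%R <= e i)%N.
  by apply: leq_trans (size_scale_leq _ _) _; rewrite sX.
move: sP; rewrite (bigD1 i) //= => sP.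
rewrite -[RHS](annihilate_polyexp _ _ _ _ _ _ sZ sP).
apply: eq_bigr => k _; congr (_ * _).
rewrite hornerZ horner_comp !hornerE /= -natrD [(k + N)%N]addnC exprD.
by rewrite mulrCA mulrA.
Qed.

(** The annihilating polynomial is monic of degree [\sum_j e j], so the relation can be solved for
    its last term. *)
Lemma recurrence_sum_polyexp (F : idomainType) (n : nat) (e : 'I_n -> nat)
    (x : 'I_n -> F) (A : 'I_n -> {poly F}) (N : nat) :
  (forall i, size (A i) <= e i)%N ->
  \sum_(i < n) (A i).[(N + \sum_(j < n) e j)%:R] * x i ^+ (N + \sum_(j < n) e j)
  = \sum_(k < \sum_(j < n) e j)
      - (\prod_(j < n) ('X - (x j)%:P) ^+ e j)`_k *
      (\sum_(i < n) (A i).[(N + k)%:R] * x i ^+ (N + k)).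
Proof.
move=> sA; have := annihilate_sum_polyexp _ _ _ x A N sA.
rewrite big_ord_recr /=.
set chi := \prod_(j < n) _.
have -> : chi`_(\sum_(j < n) e j) = 1.
  have chi_monic : chi \is monic.
    by apply: monic_prod => j _; rewrite monic_exp ?monicXsubC.
  have <- : (size chi).-1 = (\sum_(j < n) e j)%N by rewrite size_prod_exp_XsubC.
  by rewrite -lead_coefE (eqP chi_monic).
rewrite mul1r addrC => /eqP; rewrite addr_eq0 => /eqP->.
by rewrite -sumrN; apply: eq_bigr => k _; rewrite mulNr.
Qed.

Lemma pair_ratMn (r : nat) (a : 'rV[rat]_r) (x : 'cV[int]_r) (N : nat) :
  pair_rat a (x *+ N) = pair_rat a x * N%:R.
Proof. by rewrite /pair_rat raddfMn /= raddfMn /= mulmxnE mulr_natr. Qed.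

Lemma dominantMn (D : root_datum) (x : cochar D) (N : nat) :
  dominant x -> dominant (x *+ N).
Proof.
move=> dx i /dx; rewrite /pair_int raddfMn /= mulmxnE => ?.
exact: mulrn_wge0.
Qed.

(** The slope is chosen before [mu] and [B], and only the intercept depends on [mu]; this makes the
    recurrence uniform in [mu]. *)
Lemma affine_on_ray (D : root_datum) (C : cell (rd_rank D))
    (f : cochar D -> cochar D -> int) (lam : cochar D) :
  affine_on C f -> dominant lam ->
  exists s : int, forall (mu : cochar D) (B : rat), dominant mu ->
    (forall N : nat, B < N%:R -> in_cell C mu (lam *+ N)) ->
    exists t : int, forall N : nat, B < N%:R -> f mu (lam *+ N) = s * N%:Z + t.
Proof.
move=> [alam [amu [a0 Hf]]] dlam.
(* The floor provides an integer before any ray in the cell is given; once one is, the rational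
   slope is shown to equal it. *)
exists (Num.floor (pair_rat alam lam)) => mu B dmu Hcell.
set s := pair_rat alam lam; set c := pair_rat amu mu + a0.
have fE N : B < N%:R -> (f mu (lam *+ N))%:~R = s * N%:R + c.
  move=> ltBN; rewrite Hf ?pair_ratMn -?addrA //; last exact: Hcell.
  exact: dominantMn.
have [N0 ltBN0] : exists N0 : nat, B < N0%:R.
  exists (Num.bound `|B|).
  exact: le_lt_trans (ler_norm _) (archi_boundP (normr_ge0 _)).
have ltBN1 : B < N0.+1%:R by apply: lt_trans ltBN0 _; rewrite ltr_nat.
have sE : s = (f mu (lam *+ N0.+1) - f mu (lam *+ N0))%:~R.
  rewrite rmorphB /= !fE // -natr1 mulrDr mulr1.
  by rewrite opprD addrACA subrr addr0 addrAC subrr add0r.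
have floorE : (Num.floor s)%:~R = s by rewrite sE intrKfloor.
exists (f mu (lam *+ N0) - Num.floor s * N0%:Z) => N ltBN.
apply: (@intr_inj rat).
rewrite rmorphD rmorphB /= !rmorphM /= floorE !fE //.
by congr (_ + _); rewrite [_ + c]addrC addrK.
Qed.

Lemma q_neq0 : q != 0.
Proof. by rewrite tofrac_eq0 polyX_eq0. Qed.

Lemma presburger_term_ray (D : root_datum) (S : presburger_presentation D)
    (b : 'I_(pp_s S)) (i : 'I_(pp_n S)) (lam : cochar D) : dominant lam ->
  exists a : int, forall (mu : cochar D) (B : rat), dominant mu ->
    (forall N : nat, B < N%:R -> in_cell (pp_cell b) mu (lam *+ N)) ->
    exists2 A : {poly Qq}, (size A <= (pp_nbeta i).+1)%N &
      forall N : nat, B < N%:R ->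
        (\prod_(j < pp_nbeta i) (pp_beta j mu (lam *+ N))%:~R)
          * q ^ pp_alpha i mu (lam *+ N)
          / \prod_(k < pp_nden i) (1 - q ^ pp_a k)
        = A.[N%:R] * (q ^ a) ^+ N.
Proof.
move=> dlam; have [a Ha] := affine_on_ray _ _ _ _ (pp_alpha_affine b i) dlam.
exists a => mu B dmu Hcell; have [t Ht] := Ha mu B dmu Hcell.
(* These slopes and intercepts may vary with [mu]: they enter only [A], and the recurrence sees only
   the bound on its degree. *)
have /choice[u Hu] : forall j : 'I_(pp_nbeta i), exists st : int * int,
    forall N : nat, B < N%:R -> pp_beta j mu (lam *+ N) = st.1 * N%:Z + st.2.
  move=> j; have [s Hs] := affine_on_ray _ _ _ _ (pp_beta_affine b j) dlam.
  by have [t' ?] := Hs mu B dmu Hcell; exists (s, t').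
pose den : Qq := \prod_(k < pp_nden i) (1 - q ^ pp_a k).
pose lin j : {poly Qq} := (u j).1%:~R *: 'X + (u j).2%:~R%:P.
exists ((q ^ t / den) *: \prod_j lin j).
  apply: leq_trans (size_scale_leq _ _) _.
  (* With [n] factors of size at most 2, the bound is [(2n + 1) - n = n + 1]. *)
  apply: leq_trans (size_poly_prod_leq _ _) _.
  have : (\sum_j size (lin j) <= \sum_(j < pp_nbeta i) 2)%N.
    apply: leq_sum => j _; apply: leq_trans (size_polyD _ _) _.
    rewrite geq_max (leq_trans (size_scale_leq _ _)) ?size_polyX //=.
    by rewrite (leq_trans (size_polyC_leq1 _)).
  rewrite sum_nat_const cardT size_enum_ord => le_s.
  by rewrite leq_subLR addnS ltnS addnn -muln2.
move=> N ltBN; rewrite hornerZ horner_prod Ht // expfzDr ?q_neq0 // -exprz_exp.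
have -> : \prod_(j < pp_nbeta i) (pp_beta j mu (lam *+ N))%:~R
    = \prod_j (lin j).[N%:R].
  apply: eq_bigr => j _.
  by rewrite Hu // hornerD hornerZ hornerX hornerC rmorphD rmorphM.
rewrite -/den -exprnP.
by rewrite [_ * q ^ t]mulrC mulrCA !mulrA mulrC !mulrA [den^-1 * _]mulrC.
Qed.

Theorem proposition1 (D : root_datum) (S : presburger_presentation D)
    (b : 'I_(pp_s S)) :
  exists2 M : nat, (0 < M)%N &
  forall m : nat,
  exists d : nat,
  forall lam : cochar D, dominant lam ->
  exists (a : 'I_(pp_n S) -> int) (c : 'I_d -> Qq),
  forall (mu : cochar D) (B : rat), dominant mu -> 0 < B ->
    (forall N : nat, B < N%:R -> in_cell (pp_cell b) mu (lam *+ N)) ->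
    (exists A : 'I_(pp_n S) -> {poly Qq},
       forall N : nat, B < N%:R -> N = m %[mod M] ->
         tofrac (sphKL mu (lam *+ N)) =
         \sum_(i < pp_n S) (A i).[N%:R] * (q ^ a i) ^+ N)
    /\
    (forall N : nat, B < N%:R -> N = m %[mod M] ->
       tofrac (sphKL mu (lam *+ (N + d * M))) =
       \sum_(k < d) c k * tofrac (sphKL mu (lam *+ (N + k * M)))).
Proof.
exists 1%N => // m; exists (\sum_(i < pp_n S) (pp_nbeta i).+1)%N => lam dlam.
have /choice[a Ha] := fun i => presburger_term_ray D S b i lam dlam.
(* The exponent [(pp_nbeta i).+1] bounds the size of the [i]-th polynomial, so [chi] is fixed before
   [mu] and [B], and its degree is [d]. *)
pose chi := \prod_(i < pp_n S) ('X - (q ^ a i)%:P) ^+ (pp_nbeta i).+1.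
exists a, (fun k => - chi`_k) => mu B dmu _ Hcell.
have /choice[A HA] : forall i, exists A : {poly Qq},
    (size A <= (pp_nbeta i).+1)%N /\ forall N : nat, B < N%:R ->
      (\prod_(j < pp_nbeta i) (pp_beta j mu (lam *+ N))%:~R)
        * q ^ pp_alpha i mu (lam *+ N)
        / \prod_(k < pp_nden i) (1 - q ^ pp_a k)
      = A.[N%:R] * (q ^ a i) ^+ N.
  by move=> i; have [A ? ?] := Ha i mu B dmu Hcell; exists A.
have PE N : B < N%:R -> tofrac (sphKL mu (lam *+ N)) =
    \sum_(i < pp_n S) (A i).[N%:R] * (q ^ a i) ^+ N.
  move=> ltBN; rewrite (pp_formula S) //; last exact: dominantMn.
  by apply: eq_bigr => i _; rewrite (HA i).2.
have ltBD (N k : nat) : B < N%:R -> B < (N + k)%:R.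
  by move=> /lt_le_trans-> //; rewrite ler_nat leq_addr.
split; first by exists A => N ltBN _; exact: PE.
move=> N ltBN _; rewrite muln1 PE ?ltBD //.
rewrite recurrence_sum_polyexp => [|i]; last exact: (HA i).1.
by apply: eq_bigr => k _; rewrite muln1 PE ?ltBD.
Qed.
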